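(* Let $m$ be a positive integer and $\lambda$ a nonzero real number. For every $n\ge0$, $$D_{m,\lambda}(n,x)=\sum_{i=0}^{n}\binom{n}{i}m^{i}(1)_{n-i,\lambda}\,\mathrm{Bel}_{i,\lambda/m}\!\left(\frac{x}{m}\right).$$
   Context: For a nonzero real $\mu$: $(x)_{0,\mu}=1$, $(x)_{n,\mu}=x(x-\mu)\cdots(x-(n-1)\mu)$; $(x)_n=(x)_{n,1}$. Degenerate Stirling numbers of the second kind: $(x)_{n,\mu}=\sum_{k=0}^{n}S_{2,\mu}(n,k)(x)_{k}$; degenerate Bell polynomials: $\mathrm{Bel}_{n,\mu}(x)=\sum_{k=0}^{n}S_{2,\mu}(n,k)x^{k}$. Degenerate Whitney numbers of the second kind $W_{m,\lambda}(n,k)$: $(mx+1)_{n,\lambda}=\sum_{k=0}^{n}W_{m,\lambda}(n,k)m^{k}(x)_{k}$; degenerate Dowling polynomials $D_{m,\lambda}(n,x)=\sum_{k=0}^{n}W_{m,\lambda}(n,k)x^{k}$. *)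

(* Defs.v *)
From mathcomp Require Import all_boot all_order all_algebra.
From mathcomp Require Import boolp reals.
From mathcomp Require Import ring.

Set Implicit Arguments.
Unset Strict Implicit.
Unset Printing Implicit Defensive.
Import Order.TTheory GRing.Theory Num.Theory.
Local Open Scope ring_scope.

(* (x)_{n,mu}; the ordinary falling factorial (x)_n is [dfall 1 x n]. *)
Definition dfall (R : realType) (mu x : R) (n : nat) : R :=
  \prod_(i < n) (x - i%:R * mu).

(* The numbers S_{2,mu}(n,k) and W_{m,lambda}(n,k) are the coefficients of the
   expansions below; they are given the value 0 for k > n, where the
   expansions leave them unspecified.  For m > 0 this determines them uniquely
   (dstirling2_uniq, dwhitney_uniq). *)
Definition is_dstirling2 (R : realType) (mu : R) (n : nat) (c : nat -> R) :=
  (forall k, (n < k)%N -> c k = 0) /\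
  (forall x : R, dfall mu x n = \sum_(0 <= k < n.+1) c k * dfall 1 x k).

Definition is_dwhitney (R : realType) (m : nat) (lambda : R) (n : nat)
    (c : nat -> R) :=
  (forall k, (n < k)%N -> c k = 0) /\
  (forall x : R, dfall lambda (m%:R * x + 1) n =
     \sum_(0 <= k < n.+1) c k * m%:R ^+ k * dfall 1 x k).

Lemma dfallS (R : realType) (mu x : R) n :
  dfall mu x n.+1 = dfall mu x n * (x - n%:R * mu).
Proof. by rewrite /dfall big_ord_recr. Qed.

Lemma dfall_expansion (R : realType) (a b mu : R) (n : nat) :
  exists c : nat -> R, (forall k, (n < k)%N -> c k = 0) /\
    (forall x : R, dfall mu (a * x + b) n =
       \sum_(0 <= k < n.+1) c k * a ^+ k * dfall 1 x k).
Proof.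
elim: n => [|n [c [c0 cE]]].
  exists (fun k => (k == 0)%:R); split; first by case.
  by move=> x; rewrite big_nat1 /dfall !big_ord0 expr0 !mulr1.
exists (fun k => (if k is j.+1 then c j else 0)
                 + (a * k%:R + b - n%:R * mu) * c k); split.
  by case=> // k ltnk; rewrite (c0 k) // (c0 k.+1) ?mulr0 ?addr0 // ltnW.
move=> x; rewrite dfallS cE.
under [RHS]eq_bigr do rewrite 2!mulrDl.
rewrite big_split big_nat_recl //= !mul0r add0r.
rewrite [X in _ = _ + X]big_nat_recr //= c0 // mulr0 !mul0r addr0.
rewrite -big_split mulr_suml; apply: eq_bigr => k _ /=.
by rewrite exprS dfallS mulr1; ring.
Qed.

Lemma dfall1_nat (R : realType) (j k : nat) :
  (j < k)%N -> dfall 1 (j%:R : R) k = 0.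
Proof.
by move=> ltjk; rewrite /dfall (bigD1 (Ordinal ltjk)) //= mulr1 subrr mul0r.
Qed.

Lemma dfall1_nn_neq0 (R : realType) (k : nat) : dfall 1 (k%:R : R) k != 0.
Proof.
apply/prodf_neq0 => i _; rewrite mulr1 subr_eq0 eqr_nat.
by rewrite neq_ltn ltn_ord orbT.
Qed.

Lemma dfall_expansion_inj (R : realType) (a : R) (n : nat) (c d : nat -> R) :
  a != 0 ->
  (forall k, (n < k)%N -> c k = 0) -> (forall k, (n < k)%N -> d k = 0) ->
  (forall x : R, \sum_(0 <= k < n.+1) c k * a ^+ k * dfall 1 x k =
                 \sum_(0 <= k < n.+1) d k * a ^+ k * dfall 1 x k) ->
  c =1 d.
Proof.
move=> a0 c0 d0 cd; elim/ltn_ind => k IH.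
have [ltnk|lekn] := ltnP n k; first by rewrite c0 ?d0.
have cut (e : nat -> R) :
    \sum_(0 <= i < n.+1) e i * a ^+ i * dfall 1 (k%:R) i =
    \sum_(0 <= i < k) e i * a ^+ i * dfall 1 (k%:R) i
    + e k * a ^+ k * dfall 1 (k%:R) k.
  rewrite (@big_cat_nat _ _ _ k.+1) //= big_nat_recr //=.
  rewrite [X in _ + X]big_nat [X in _ + X]big1 ?addr0 // => i /andP[ltki _].
  by rewrite dfall1_nat ?mulr0.
have := cd k%:R; rewrite !cut.
under eq_big_nat => i /andP[_ ltik] do rewrite IH //.
move=> /addrI /(mulIf (dfall1_nn_neq0 R k)).
by apply: mulIf; rewrite expf_neq0.
Qed.

Lemma dstirling2_ex (R : realType) (mu : R) (n : nat) :
  exists c, is_dstirling2 mu n c.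
Proof.
have [c [c0 cE]] := dfall_expansion 1 0 mu n; exists c; split=> // x.
have := cE x; rewrite mul1r addr0 => ->.
by apply: eq_bigr => k _; rewrite expr1n mulr1.
Qed.

Lemma dwhitney_ex (R : realType) (m : nat) (lambda : R) (n : nat) :
  exists c, is_dwhitney m lambda n c.
Proof. exact: dfall_expansion. Qed.

Definition dstirling2 (R : realType) (mu : R) (n : nat) : nat -> R :=
  projT1 (cid (dstirling2_ex mu n)).

Definition dwhitney (R : realType) (m : nat) (lambda : R) (n : nat) : nat -> R :=
  projT1 (cid (dwhitney_ex m lambda n)).

Lemma dstirling2P (R : realType) (mu : R) n :
  is_dstirling2 mu n (dstirling2 mu n).
Proof. exact: projT2 (cid _). Qed.

Lemma dwhitneyP (R : realType) m (lambda : R) n :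
  is_dwhitney m lambda n (dwhitney m lambda n).
Proof. exact: projT2 (cid _). Qed.

Lemma dstirling2_uniq (R : realType) (mu : R) n c :
  is_dstirling2 mu n c -> c =1 dstirling2 mu n.
Proof.
move=> [c0 cE]; have [d0 dE] := dstirling2P mu n.
apply: (dfall_expansion_inj (oner_neq0 R) c0 d0) => x.
under eq_bigr do rewrite expr1n mulr1.
under [RHS]eq_bigr do rewrite expr1n mulr1.
by rewrite -cE -dE.
Qed.

Lemma dwhitney_uniq (R : realType) m (lambda : R) n c : (0 < m)%N ->
  is_dwhitney m lambda n c -> c =1 dwhitney m lambda n.
Proof.
move=> m0 [c0 cE]; have [d0 dE] := dwhitneyP m lambda n.
have mR0 : m%:R != 0 :> R by rewrite pnatr_eq0 -lt0n.
by apply: (dfall_expansion_inj mR0 c0 d0) => x; rewrite -cE -dE.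
Qed.

Definition dbell (R : realType) (mu : R) (n : nat) : {poly R} :=
  \sum_(0 <= k < n.+1) dstirling2 mu n k *: 'X^k.

Definition ddowling (R : realType) (m : nat) (lambda : R) (n : nat) : {poly R} :=
  \sum_(0 <= k < n.+1) dwhitney m lambda n k *: 'X^k.

(* Main.v *)
Require Import Defs.
From mathcomp Require Import all_boot all_order all_algebra.
From mathcomp Require Import boolp reals.
From mathcomp Require Import ring.

Set Implicit Arguments.
Unset Strict Implicit.
Unset Printing Implicit Defensive.
Import Order.TTheory GRing.Theory Num.Theory.
Local Open Scope ring_scope.

(** Expand [(m x + 1)_{n,lambda}] by the degenerate Vandermonde identity and
    rescale [(m x)_{i,lambda} = m^i (x)_{i,lambda/m}]: since the Whitney
    coefficients are unique, this gives
    [W(n,k) m^k = \sum_i C(n,i) m^i (1)_{n-i,lambda} S_{2,lambda/m}(i,k)].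
    Multiplying by [(x/m)^k] and summing over [k] gives the claim. *)

Lemma dfall_scale (R : realType) (mu a x : R) (n : nat) : a != 0 ->
  dfall mu (a * x) n = a ^+ n * dfall (mu / a) x n.
Proof.
move=> a0; rewrite /dfall -[in a ^+ n](card_ord n) -prodr_const -big_split /=.
by apply: eq_bigr => i _; field.
Qed.

(** Induction on [n]: in the [i]-th term the new factor splits as [(a - i mu) + (b - (n - i) mu)],
    each part extending one of the two falling factorials; Pascal's rule then collects the terms. *)
Lemma dfallD (R : realType) (mu a b : R) (n : nat) :
  dfall mu (a + b) n =
  \sum_(0 <= i < n.+1) 'C(n, i)%:R * dfall mu a i * dfall mu b (n - i).
Proof.
elim: n => [|n IHn]; first by rewrite big_nat1 /dfall !big_ord0 !mulr1.
rewrite dfallS IHn mulr_suml.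
have step i : (0 <= i < n.+1)%N ->
    'C(n, i)%:R * dfall mu a i * dfall mu b (n - i) * (a + b - n%:R * mu) =
    'C(n, i)%:R * dfall mu a i.+1 * dfall mu b (n - i)
    + 'C(n, i)%:R * dfall mu a i * dfall mu b (n.+1 - i).
  move=> /andP[_]; rewrite ltnS => lein.
  by rewrite subSn // !dfallS natrB //; ring.
rewrite (eq_big_nat _ _ step) big_split /=.
(* The added term [i = n.+1] vanishes since ['C(n, n.+1) = 0]; without its term [i = 0], the longer
   sum matches the other one after a shift by one. *)
have -> : \sum_(0 <= i < n.+1) 'C(n, i)%:R * dfall mu a i
              * dfall mu b (n.+1 - i) =
    \sum_(0 <= i < n.+2) 'C(n, i)%:R * dfall mu a i * dfall mu b (n.+1 - i).
  by rewrite [RHS]big_nat_recr //= bin_small // !mul0r addr0.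
rewrite addrC [X in X + _]big_nat_recl // [RHS]big_nat_recl // !bin0 -addrA
  -big_split /=.
congr (_ + _); apply: eq_bigr => i _.
by rewrite subSS binS natrD; ring.
Qed.

(** Since [S(i,k)] vanishes for [k > i], this gives the inner sums over [k] a bound independent of
    [i], as exchanging the two summations requires. *)
Lemma sum_nat_widen0 (V : nmodType) (i n : nat) (F : nat -> V) : (i <= n)%N ->
  (forall k, (i <= k)%N -> F k = 0) ->
  \sum_(0 <= k < i) F k = \sum_(0 <= k < n) F k.
Proof.
move=> lein F0; rewrite [RHS](@big_cat_nat _ _ _ i) //=.
by rewrite [X in _ + X]big_nat [X in _ + X]big1 ?addr0 // => k /andP[/F0].
Qed.

Lemma dwhitney_dstirling2 (R : realType) (m : nat) (lambda : R) (n k : nat) :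
  (0 < m)%N ->
  dwhitney m lambda n k =
  (\sum_(0 <= i < n.+1) 'C(n, i)%:R * m%:R ^+ i * dfall lambda 1 (n - i)
     * dstirling2 (lambda / m%:R) i k) / m%:R ^+ k.
Proof.
move=> m0; have mR0 : m%:R != 0 :> R by rewrite pnatr_eq0 -lt0n.
(* Uniqueness concerns whole sequences, so [k] is generalized first; the explicit formula must then
   vanish for [k > n] and satisfy the defining expansion. *)
apply/esym; move: k; apply: dwhitney_uniq => //; split=> [k ltnk|x].
  rewrite big_nat big1 ?mul0r // => i /andP[_ ltin].
  have [S0 _] := dstirling2P (lambda / m%:R) i.
  by rewrite S0 ?mulr0 // (leq_trans _ ltnk).
under [RHS]eq_bigr do rewrite divfK ?expf_neq0 // mulr_suml.
(* Vandermonde with [a = m x] and [b = 1], compared term by term in [i]. *)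
rewrite exchange_big dfallD; apply: eq_big_nat => i /andP[_ lein].
have [S0 SE] := dstirling2P (lambda / m%:R) i.
rewrite dfall_scale // SE (sum_nat_widen0 lein); last first.
  by move=> k /S0 ->; rewrite mul0r.
by rewrite mulr_sumr mulr_sumr mulr_suml; apply: eq_bigr => k _; ring.
Qed.

Theorem theorem23 (R : realType) (m : nat) (lambda : R)
    (hm : (0 < m)%N) (hlambda : lambda != 0) (n : nat) (x : R) :
  (ddowling m lambda n).[x] =
  \sum_(0 <= i < n.+1)
    'C(n, i)%:R * m%:R ^+ i * dfall lambda 1 (n - i)
    * (dbell (lambda / m%:R) i).[x / m%:R].
Proof.
rewrite /ddowling horner_sum.
(* The denominator [m ^ k] is absorbed into [x ^ k], which produces the argument [x / m]. *)
under eq_bigr do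
  rewrite hornerZ hornerXn dwhitney_dstirling2 // mulrAC -mulrA -expr_div_n
    mulr_suml.
rewrite exchange_big; apply: eq_big_nat => i /andP[_ lein].
rewrite /dbell horner_sum (sum_nat_widen0 lein) => [|k ltik].
  by rewrite mulr_sumr; apply: eq_bigr => k _; rewrite hornerZ hornerXn mulrA.
have [S0 _] := dstirling2P (lambda / m%:R) i.
by rewrite S0 // scale0r horner0.
Qed.
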